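(* Let $\mathcal{G}$ be a switched affine (SWA) model with modes $G_i=\{\mathbf{A}_i,\mathbf{B}_i,\mathbf{C}_i,\mathbf{D}_i,\mathbf{f}_i,\mathbf{g}_i\}$, $i\in\{1,\dots,m\}$, let $N$ be a positive integer, and let $\{\mathbf{u}_t,\mathbf{y}_t\}_{t=0}^{N-1}$ be an input-output sequence with $\|\mathbf{u}_t\|\le U$ for all $t$. Then the model $\mathcal{G}$ is invalidated by the sequence, i.e. $\{\mathbf{u}_t,\mathbf{y}_t\}_{t=0}^{N-1}\notin\mathcal{B}^N_{swa}(\mathcal{G})$, if and only if the following feasibility problem is infeasible: Find $\mathbf{x}_t\in\mathbb{R}^n$ (for $0\le t\le N$), $\boldsymbol{\eta}_t\in\mathbb{R}^{n_y}$, $\boldsymbol{\nu}_t\in\mathbb{R}^{n}$, $a_{i,t}$, $\mathbf{s}_{i,t}\in\mathbb{R}^n$, $\mathbf{r}_{i,t}\in\mathbb{R}^{n_y}$ (for $0\le t\le N-1$, $1\le i\le m$) such that for all $t\in\{0,\dots,N-1\}$, all $i\in\{1,\dots,m\}$, all $j\in\{1,\dots,n\}$ and all $k\in\{1,\dots,n_y\}$: \begin{align*} &\mathbf{x}_{t+1}=\mathbf{A}_i\mathbf{x}_t+\mathbf{B}_i\mathbf{u}_t+\mathbf{f}_i+\boldsymbol{\nu}_t+\mathbf{s}_{i,t},\\ &\mathbf{y}_t=\mathbf{C}_i\mathbf{x}_t+\mathbf{D}_i\mathbf{u}_t+\mathbf{g}_i+\boldsymbol{\eta}_t+\mathbf{r}_{i,t},\\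 &P\mathbf{x}_t\le p,\quad a_{i,t}\in\{0,1\},\quad \textstyle\sum_{i=1}^m a_{i,t}=1,\\ &\|\boldsymbol{\nu}_t\|\le\epsilon_\nu,\quad \|\boldsymbol{\eta}_t\|\le\epsilon_\eta,\\ &(a_{i,t},\mathbf{s}^j_{i,t})\ \text{is SOS-1},\quad (a_{i,t},\mathbf{r}^k_{i,t})\ \text{is SOS-1}. \end{align*}
   Context: Notation: $\|\cdot\|$ is the infinity norm on vectors; $\mathbf{v}^j$ is the $j$-th entry of a vector $\mathbf{v}$; vector inequalities are entrywise. SWA model: $\mathcal{G}=(\mathcal{X},\mathcal{E},\mathcal{U},\{G_i\}_{i=1}^m)$, where $\mathcal{X}=\{\mathbf{x}\in\mathbb{R}^n: P\mathbf{x}\le p\}$ is the set of admissible states (convex and compact; $P$ a real matrix with $n$ columns, $p$ a real vector), $\mathcal{E}=\{[\boldsymbol{\eta}^\intercal\ \boldsymbol{\nu}^\intercal]^\intercal: \|\boldsymbol{\eta}\|\le\epsilon_\eta,\ \|\boldsymbol{\nu}\|\le\epsilon_\nu\}$ is the set of admissible measurement noise $\boldsymbol{\eta}\in\mathbb{R}^{n_y}$ and process noise $\boldsymbol{\nu}\in\mathbb{R}^{n}$, $\mathcal{U}=\{\mathbf{u}\in\mathbb{R}^{n_u}:\|\mathbf{u}\|\le U\}$ is the set of admissible inputs, and each mode $G_i=\{\mathbf{A}_i,\mathbf{B}_i,\mathbf{C}_i,\mathbf{D}_i,\mathbf{f}_i,\mathbf{g}_i\}$ consists of real matrices and vectors of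 compatible dimensions. The evolution is $$\mathbf{x}_{t+1}=\mathbf{A}_{\sigma_t}\mathbf{x}_t+\mathbf{B}_{\sigma_t}\mathbf{u}_t+\mathbf{f}_{\sigma_t}+\boldsymbol{\nu}_t,\qquad \mathbf{y}_t=\mathbf{C}_{\sigma_t}\mathbf{x}_t+\mathbf{D}_{\sigma_t}\mathbf{u}_t+\mathbf{g}_{\sigma_t}+\boldsymbol{\eta}_t,$$ where $\sigma_t\in\{1,\dots,m\}$ is the active mode at time $t$. Length-$N$ behavior: $\mathcal{B}^N_{swa}(\mathcal{G})$ is the set of all sequences $\{\mathbf{u}_t,\mathbf{y}_t\}_{t=0}^{N-1}$ with $\mathbf{u}_t\in\mathcal{U}$ for which there exist $\mathbf{x}_t\in\mathcal{X}$, $\sigma_t\in\{1,\dots,m\}$, $[\boldsymbol{\eta}_t^\intercal\ \boldsymbol{\nu}_t^\intercal]^\intercal\in\mathcal{E}$ for $t=0,\dots,N-1$ such that the evolution equations hold for $t=0,\dots,N-1$ (the state $\mathbf{x}_N$ appearing in the equation for $t=N-1$ is any vector of $\mathbb{R}^n$; it is not required to lie in $\mathcal{X}$). SOS-1 (special ordered set of degree 1): a tuple of variables is SOS-1 if at most one of its entries is non-zero. Thus the slack variables $\mathbf{s}_{i,t},\mathbf{r}_{i,t}$ are zero when $a_{i,t}=1$ and free when $a_{i,t}=0$. *)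

(* Defs.v *)
(* MathComp-Analysis. On 'cV[R]_k the library norm `|v| is mx_norm, the largest
   absolute value of an entry, i.e. the infinity norm. *)
From mathcomp Require Import all_boot all_order all_algebra.
From mathcomp Require Import all_classical all_reals all_analysis.

Set Implicit Arguments.
Unset Strict Implicit.
Unset Printing Implicit Defensive.

Import Order.TTheory GRing.Theory Num.Theory.
Import numFieldNormedType.Exports.

Local Open Scope classical_set_scope.
Local Open Scope ring_scope.

Definition vec_le (R : realType) (k : nat) (v w : 'cV[R]_k) : Prop :=
  forall j, v j 0 <= w j 0.

Definition polyhedron (R : realType) (q n : nat) (P : 'M[R]_(q, n))
    (p : 'cV[R]_q) : set 'cV[R]_n :=
  [set x | vec_le (P *m x) p].

Record swa_mode (R : realType) (n nu ny : nat) := SwaMode {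
  mode_A : 'M[R]_(n, n);
  mode_B : 'M[R]_(n, nu);
  mode_C : 'M[R]_(ny, n);
  mode_D : 'M[R]_(ny, nu);
  mode_f : 'cV[R]_n;
  mode_g : 'cV[R]_ny }.

(* n, nu, ny: dimensions of state, input and output; q: number of rows of P;
   m: number of modes. Convexity of {x | P x <= p} holds for every P and p, so
   only its compactness is a field. *)
Record swa_model (R : realType) (n nu ny q m : nat) := SwaModel {
  swa_P : 'M[R]_(q, n);
  swa_p : 'cV[R]_q;
  swa_compact : compact (polyhedron swa_P swa_p);
  swa_eps_eta : R;
  swa_eps_nu : R;
  swa_U : R;
  swa_modes : 'I_m -> swa_mode R n nu ny }.

Section SwaSets.
Context (R : realType) (n nu ny q m : nat).
Variable G : swa_model R n nu ny q m.

Definition state_set : set 'cV[R]_n := polyhedron (swa_P G) (swa_p G).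

Definition noise_set : set 'cV[R]_(ny + n) :=
  [set e | `|usubmx e| <= swa_eps_eta G /\ `|dsubmx e| <= swa_eps_nu G].

Definition input_set : set 'cV[R]_nu := [set u | `|u| <= swa_U G].

End SwaSets.

(* For a trajectory x_0, ..., x_N and t : 'I_N, before x t is x_t and after x t is
   x_{t+1}. *)
Definition before (T : Type) (N : nat) (x : 'I_N.+1 -> T) (t : 'I_N) : T :=
  x (widen_ord (leqnSn N) t).

Definition after (T : Type) (N : nat) (x : 'I_N.+1 -> T) (t : 'I_N) : T :=
  x (lift ord0 t).

Definition swa_behavior (R : realType) (n nu ny q m : nat)
    (G : swa_model R n nu ny q m) (N : nat) :
    set ('I_N -> 'cV[R]_nu * 'cV[R]_ny) :=
  [set w | (forall t, input_set G (w t).1) /\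
    exists (x : 'I_N.+1 -> 'cV[R]_n) (sigma : 'I_N -> 'I_m)
           (eta : 'I_N -> 'cV[R]_ny) (v : 'I_N -> 'cV[R]_n),
    forall t,
      let: g := swa_modes G (sigma t) in
      [/\ state_set G (before x t),
          noise_set G (col_mx (eta t) (v t)),
          after x t = mode_A g *m before x t + mode_B g *m (w t).1
                     + mode_f g + v t
        & (w t).2 = mode_C g *m before x t + mode_D g *m (w t).1
                    + mode_g g + eta t]].

Definition sos1 (R : realType) (s : seq R) : Prop :=
  (count (predC1 (0 : R)%R) s <= 1)%N.

Definition sos1_program_feasible (R : realType) (n nu ny q m : nat)
    (G : swa_model R n nu ny q m) (N : nat)
    (u : 'I_N -> 'cV[R]_nu) (y : 'I_N -> 'cV[R]_ny) : Prop :=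
  exists (x : 'I_N.+1 -> 'cV[R]_n) (eta : 'I_N -> 'cV[R]_ny)
         (v : 'I_N -> 'cV[R]_n) (a : 'I_m -> 'I_N -> R)
         (s : 'I_m -> 'I_N -> 'cV[R]_n) (r : 'I_m -> 'I_N -> 'cV[R]_ny),
  forall t,
    [/\ forall i,
          let: g := swa_modes G i in
          after x t = mode_A g *m before x t + mode_B g *m u t
                     + mode_f g + v t + s i t
          /\ y t = mode_C g *m before x t + mode_D g *m u t
                   + mode_g g + eta t + r i t,
        vec_le (swa_P G *m before x t) (swa_p G),
        (forall i, a i t = 0 \/ a i t = 1) /\ \sum_(i < m) a i t = 1,
        `|v t| <= swa_eps_nu G /\ `|eta t| <= swa_eps_eta G
      & forall i,
          (forall j, sos1 [:: a i t; s i t j 0])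
          /\ (forall k, sos1 [:: a i t; r i t k 0])].

(* Main.v *)
(* A feasible point and an admissible run determine each other: the binary
   variables a_{i,t} are the indicator of sigma_t = i. The SOS-1 constraints
   force the slacks of the active mode to vanish, and leave those of the
   inactive modes free to absorb whatever residual their equations have. *)
Require Import Defs.
From mathcomp Require Import all_boot all_order all_algebra.
From mathcomp Require Import all_classical all_reals all_analysis.
Import Order.TTheory GRing.Theory Num.Theory.
Import numFieldNormedType.Exports.
Local Open Scope ring_scope.

Lemma sos1_0l (R : realType) (z : R) : sos1 [:: 0; z].
Proof. by rewrite /sos1 /= eqxx; case: (z != 0). Qed.

Lemma sos1_0r (R : realType) (z : R) : sos1 [:: z; 0].
Proof. by rewrite /sos1 /= eqxx; case: (z != 0). Qed.

(** The entry 1 already takes up the single nonzero place. *)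
Lemma sos1_1l (R : realType) (z : R) : sos1 [:: 1; z] -> z = 0.
Proof. by rewrite /sos1 /= oner_eq0; case: eqP. Qed.

Lemma sos1_col_eq0 (R : realType) (k : nat) (v : 'cV[R]_k) :
  (forall j, sos1 [:: 1; v j 0]) -> v = 0.
Proof. by move=> hv; apply/colP => j; rewrite mxE; exact: sos1_1l. Qed.

(** Otherwise every term would be 0, and the sum would be 0 rather than 1. *)
Lemma binary_sum1_exists (R : realType) (m : nat) (a : 'I_m -> R) :
  (forall i, a i = 0 \/ a i = 1) -> \sum_(i < m) a i = 1 -> exists i, a i = 1.
Proof.
move=> a01 suma; apply: contrapT => no1.
have := oner_neq0 R; rewrite -suma big1 ?eqxx // => i _.
by case: (a01 i) => // ai1; case: no1; exists i.
Qed.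

Lemma behavior_feasible (R : realType) (n nu ny q m : nat)
    (G : swa_model R n nu ny q m) (N : nat)
    (u : 'I_N -> 'cV[R]_nu) (y : 'I_N -> 'cV[R]_ny) :
  swa_behavior G (fun t => (u t, y t)) -> sos1_program_feasible G u y.
Proof.
case=> _ [x [sigma [eta [v run]]]].
pose g i := swa_modes G i.
(* [xhat] and [yhat] are the predictions of mode [i] under the run's own noise. With the residuals
   as slacks, the equations of every mode hold identically. *)
pose xhat i t := mode_A (g i) *m before x t + mode_B (g i) *m u t
  + mode_f (g i) + v t.
pose yhat i t := mode_C (g i) *m before x t + mode_D (g i) *m u t
  + mode_g (g i) + eta t.
exists x, eta, v, (fun i t => (i == sigma t)%:R),
  (fun i t => after x t - xhat i t), (fun i t => y t - yhat i t) => t.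
have [Xt Et xt /= yt] := run t.
move: Et; rewrite /noise_set /= col_mxKu col_mxKd => -[etat vt].
split=> //.
- by move=> i; split; rewrite [RHS]addrC subrK.
- split=> [i|]; first by case: eqP; [right | left].
  by rewrite (bigD1 (sigma t)) //= eqxx big1 ?addr0 // => i /negPf ->.
(* At the active mode the run's equations make both residuals zero; at any other mode the binary
   variable is 0. *)
- move=> i; case: (eqVneq i (sigma t)) => [->|_].
    by rewrite xt yt !subrr; split=> j; rewrite mxE; exact: sos1_0r.
  by split=> j; exact: sos1_0l.
Qed.

Lemma feasible_behavior (R : realType) (n nu ny q m : nat)
    (G : swa_model R n nu ny q m) (N : nat)
    (u : 'I_N -> 'cV[R]_nu) (y : 'I_N -> 'cV[R]_ny) :
  (forall t, `|u t| <= swa_U G) ->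
  sos1_program_feasible G u y -> swa_behavior G (fun t => (u t, y t)).
Proof.
(* The input bound is part of the behavior but not a constraint of the program, so it comes from
   [hu]. *)
move=> hu [x [eta [v [a [s [r feas]]]]]]; split=> //.
(* Choosing at each time a mode whose binary variable is 1 gives the switching sequence. *)
have /choice[sigma a1] : forall t, exists i, a i t = 1.
  by move=> t; have [_ _ [a01 suma] _ _] := feas t; exact: binary_sum1_exists.
exists x, sigma, eta, v => t.
have [dyn Xt _ [vt etat] sos] := feas t.
have [xt yt] := dyn (sigma t); have [ss sr] := sos (sigma t).
rewrite a1 in ss sr.
rewrite (sos1_col_eq0 _ _ _ ss) addr0 in xt; rewrite (sos1_col_eq0 _ _ _ sr) addr0 in yt.
by split=> //; rewrite /noise_set /= col_mxKu col_mxKd.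
Qed.

Theorem proposition1 (R : realType) (n nu ny q m : nat)
    (G : swa_model R n nu ny q m) (N : nat) (hN : (0 < N)%N)
    (u : 'I_N -> 'cV[R]_nu) (y : 'I_N -> 'cV[R]_ny)
    (hu : forall t, `|u t| <= swa_U G) :
  ~ swa_behavior G (fun t => (u t, y t)) <-> ~ sos1_program_feasible G u y.
Proof.
(* Each implication between the negations is the contrapositive of the opposite inclusion. *)
split; apply: contra_not; first exact: feasible_behavior.
exact: behavior_feasible.
Qed.
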